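(* Classically, the categories $\mathbf{Ba}_{\bigvee}$, $\mathbf{OOLat}$, $\mathbf{OHa}$ and $\mathbf{OBa}$ are all equivalent.
   Context: ''Classically'' means in a classical setting (law of excluded middle and powerset axiom available). An overlap lattice with opposite (oo-lattice) is a quadruple $(\mathcal P,\le,\bowtie,-)$ where $(\mathcal P,\le)$ is a bounded lattice (with bottom $0$ and top $1$), $-$ is a pseudo-complement operation ($p\wedge q=0\iff p\le -q$) and $\bowtie$ is a binary relation on $\mathcal P$ such that for all $p,q$: (symmetry) $p\bowtie q\Rightarrow q\bowtie p$; (meet closure) $p\bowtie q\Rightarrow p\bowtie(p\wedge q)$; (splitting of existing joins) whenever $(q_i)_{i\in I}$ is a set-indexed family whose join $\bigvee_{i\in I}q_i$ exists, $p\bowtie\bigvee_{i\in I}q_i\iff(\exists i\in I)(p\bowtie q_i)$; (density) $(\forall r\in\mathcal P)(r\bowtie p\Rightarrow r\bowtie q)\Rightarrow p\le q$. All oo-lattices are assumed set-based: there is a set $S$ of elements (a base) such that for every $p$ the join of $\{a\in S\mid a\le p\}$ exists and equals $p$. A morphism of oo-lattices from $\mathcal P$, with base $S$, to $\mathcal Q$ is a map $f:\mathcal P\to\mathcal Q$ such that for all $p\in\mathcal P$, $q\in\mathcal Q$: $f(p)\bowtie q\iff(\exists a\in S)\big(p\bowtie a\ \text{and}\ (\forall x\in S)(x\bowtie a\Rightarrow f(x)\bowtie q)\big)$. An overlap Heyting algebra is an oo-lattice whose underlying lattice is a Heyting algebra; an overlap Boolean algebra is an overlap Heyting algebra whose underlying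 lattice is a Boolean algebra. $\mathbf{OOLat}$ is the category of oo-lattices and oo-lattice morphisms; $\mathbf{OHa}$ is its full subcategory on overlap Heyting algebras; $\mathbf{OBa}$ is the full subcategory of $\mathbf{OHa}$ on overlap Boolean algebras. $\mathbf{Ba}_{\bigvee}$ is the category of Boolean algebras and maps preserving all existing joins (whenever a family $(p_i)_{i\in I}$ has a join in the domain, $f(\bigvee_{i\in I} p_i)$ is the join of $(f(p_i))_{i\in I}$ in the codomain). *)

(* Defs.v *)
From mathcomp Require Import all_boot all_order.
From mathcomp Require Import boolp classical_sets.

Set Implicit Arguments.
Unset Strict Implicit.
Unset Printing Implicit Defensive.

Import Order.TTheory.

Local Open Scope classical_set_scope.
Local Open Scope order_scope.

(* Categories, with Leibniz equality of arrows. *)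

Record category := Category {
  ob :> Type;
  hom : ob -> ob -> Type;
  idm : forall A, hom A A;
  comp : forall A B C, hom B C -> hom A B -> hom A C;
  comp_idl : forall A B (f : hom A B), comp (idm B) f = f;
  comp_idr : forall A B (f : hom A B), comp f (idm A) = f;
  comp_assoc : forall A B C D (h : hom C D) (g : hom B C) (f : hom A B),
    comp h (comp g f) = comp (comp h g) f }.

Arguments hom {c}.
Arguments idm {c}.
Arguments comp {c A B C}.

Record functor (C D : category) := Functor {
  fobj :> C -> D;
  fmap : forall A B : C, hom A B -> hom (fobj A) (fobj B);
  fmap_id : forall A : C, fmap (idm A) = idm (fobj A);
  fmap_comp : forall (A B E : C) (g : hom B E) (f : hom A B),
    fmap (comp g f) = comp (fmap g) (fmap f) }.

Arguments fmap {C D} _ {A B}.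

Program Definition functor_id (C : category) : functor C C :=
  @Functor C C (fun A => A) (fun A B f => f) _ _.

Program Definition functor_comp (C D E : category)
    (G : functor D E) (F : functor C D) : functor C E :=
  @Functor C E (fun A => G (F A)) (fun A B f => fmap G (fmap F f)) _ _.
Next Obligation. by rewrite !fmap_id. Qed.
Next Obligation. by rewrite !fmap_comp. Qed.

Definition is_iso (C : category) (A B : C) (f : hom A B) : Prop :=
  exists g : hom B A, comp g f = idm A /\ comp f g = idm B.

Definition naturally_isomorphic (C D : category) (F G : functor C D) : Prop :=
  exists t : forall A : C, hom (F A) (G A),
    (forall (A B : C) (f : hom A B),
       comp (fmap G f) (t A) = comp (t B) (fmap F f)) /\
    (forall A : C, is_iso (t A)).

Definition equivalent_categories (C D : category) : Prop :=
  exists (F : functor C D) (G : functor D C),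
    naturally_isomorphic (functor_comp G F) (functor_id C) /\
    naturally_isomorphic (functor_comp F G) (functor_id D).

Program Definition full_subcategory (C : category) (P : C -> Prop) : category :=
  @Category {A : C | P A} (fun A B => hom (sval A) (sval B))
    (fun A => idm (sval A)) (fun A B E g f => comp g f) _ _ _.
Next Obligation. by rewrite comp_idl. Qed.
Next Obligation. by rewrite comp_idr. Qed.
Next Obligation. by rewrite comp_assoc. Qed.

(* The join of a family is a supremum of its range; [is_join q s] says both
   that the join exists and that it is [s]. *)
Definition is_join (d : Order.disp_t) (L : porderType d) (I : Type)
    (q : I -> L) (s : L) : Prop :=
  supremums (range q) s.

Definition is_base (d : Order.disp_t) (L : porderType d) (S : set L) : Prop :=
  forall p : L, supremums [set a | S a /\ a <= p] p.

Definition is_heyting (d : Order.disp_t) (L : latticeType d) : Prop :=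
  forall p q : L, exists r : L, forall x : L, (x <= r) <-> (x `&` p <= q).

Definition is_boolean (d : Order.disp_t) (L : tbLatticeType d) : Prop :=
  (forall p q r : L, p `&` (q `|` r) = (p `&` q) `|` (p `&` r)) /\
  (forall p : L, exists c : L, p `&` c = \bot /\ p `|` c = \top).

(* The base is only required to exist: it is not part of the data. *)
Record ooLattice (d : Order.disp_t) := OOLattice {
  oo_lattice :> tbLatticeType d;
  overlap : oo_lattice -> oo_lattice -> Prop;
  opposite : oo_lattice -> oo_lattice;
  opposite_pseudo : forall p q : oo_lattice,
    (p `&` q = \bot) <-> (p <= opposite q);
  overlap_sym : forall p q : oo_lattice, overlap p q -> overlap q p;
  overlap_meet : forall p q : oo_lattice, overlap p q -> overlap p (p `&` q);
  overlap_join : forall (I : Type) (q : I -> oo_lattice) (s : oo_lattice),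
    is_join q s ->
    forall p : oo_lattice, overlap p s <-> exists i : I, overlap p (q i);
  overlap_density : forall p q : oo_lattice,
    (forall r : oo_lattice, overlap r p -> overlap r q) -> p <= q;
  oo_set_based : exists S : set oo_lattice, is_base S }.

Definition oo_morphism_wrt (d : Order.disp_t) (P Q : ooLattice d) (S : set P)
    (f : P -> Q) : Prop :=
  forall (p : P) (q : Q),
    overlap (f p) q <->
    exists a : P, [/\ S a, overlap p a &
      forall x : P, S x -> overlap x a -> overlap (f x) q].

(* Independent of the base, see [oo_morphismP]. *)
Definition oo_morphism (d : Order.disp_t) (P Q : ooLattice d)
    (f : P -> Q) : Prop :=
  forall S : set P, is_base S -> oo_morphism_wrt S f.

Section OOLatticeTheory.
Variable d : Order.disp_t.
Implicit Types P Q R : ooLattice d.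

Lemma is_base_join P (S : set P) : is_base S ->
  forall p : P, is_join (fun a : {a : P | S a /\ a <= p} => sval a) p.
Proof.
move=> bS p; move: (bS p); rewrite /is_join; congr (supremums _ p).
apply/seteqP; split=> [a ap|_ [[a ap] _ <-]//].
by exists (exist _ a ap).
Qed.

Lemma overlap_base P (S : set P) (p q : P) : is_base S -> overlap p q ->
  exists a, [/\ S a, a <= q & overlap p a].
Proof.
move=> /is_base_join/(_ q) Sq /(overlap_join Sq)[[a [Sa aq]] pa].
by exists a.
Qed.

Lemma overlap_le P (p q r : P) : q <= r -> overlap p q -> overlap p r.
Proof.
move=> qr pq.
have qrr : is_join (fun b : bool => if b then q else r) r.
  by split=> [_ [[] _ <-]//|x]; apply; exists false.
by apply/(overlap_join qrr); exists true.
Qed.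

Lemma oo_morphism_le P Q (S : set P) (f : P -> Q) : oo_morphism_wrt S f ->
  forall p q : P, p <= q -> f p <= f q.
Proof.
move=> fS p q pq; apply: overlap_density => r /overlap_sym/fS[a [Sa pa aP]].
apply/overlap_sym/fS; exists a; split=> //.
exact/overlap_sym/(overlap_le pq)/overlap_sym.
Qed.

Lemma oo_morphismP P Q (S : set P) (f : P -> Q) : is_base S ->
  oo_morphism_wrt S f <-> oo_morphism f.
Proof.
move=> bS; split=> [fS T bT p q|]; last exact.
split=> [/fS[a [_ pa aP]]|[a [Ta pa aP]]].
  have [b [Tb ba pb]] := overlap_base bT pa.
  exists b; split=> // x _ xb.
  have /overlap_sym/(overlap_base bS) : overlap x a by exact: overlap_le ba xb.
  move=> [z [Sz zx az]].
  have /overlap_sym qz := aP _ Sz (overlap_sym az).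
  exact/overlap_sym/(overlap_le (oo_morphism_le fS zx)).
have [z [Tz zp az]] := overlap_base bT (overlap_sym pa).
have /overlap_sym qz := aP _ Tz (overlap_sym az).
exact/overlap_sym/(overlap_le (oo_morphism_le fS zp)).
Qed.

Lemma oo_morphism_id P : oo_morphism (fun p : P => p).
Proof.
move=> S bS p q; split=> [pq|[a [Sa pa aP]]].
  have [a [Sa aq pa]] := overlap_base bS pq.
  by exists a; split=> // x _; exact: overlap_le.
have [x [Sx xp ax]] := overlap_base bS (overlap_sym pa).
have /overlap_sym qx := aP _ Sx (overlap_sym ax).
exact/overlap_sym/(overlap_le xp).
Qed.

Lemma oo_morphism_comp P Q R (g : Q -> R) (f : P -> Q) :
  oo_morphism g -> oo_morphism f -> oo_morphism (fun p => g (f p)).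
Proof.
move=> mg mf S bS p r; have fS := mf _ bS.
have [T bT] := oo_set_based Q; have gT := mg _ bT.
split=> [/gT[b [Tb fpb bP]]|[a [Sa pa aP]]].
  have /fS[a [Sa pa aP]] := fpb.
  by exists a; split=> // x Sx xa; apply/gT; exists b; split=> //; exact: aP.
have [x [Sx xp ax]] := overlap_base bS (overlap_sym pa).
have /overlap_sym gfx := aP _ Sx (overlap_sym ax).
apply/overlap_sym/(overlap_le _ gfx).
exact/(oo_morphism_le gT)/(oo_morphism_le fS).
Qed.

End OOLatticeTheory.

Program Definition OOLat (d : Order.disp_t) : category :=
  @Category (ooLattice d) (fun P Q => {f : P -> Q | oo_morphism f})
    (fun P => exist _ (fun p => p) (@oo_morphism_id d P))
    (fun P Q R g f => exist _ (fun p => sval g (sval f p))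
                        (oo_morphism_comp (svalP g) (svalP f))) _ _ _.
Next Obligation. exact: eq_exist. Qed.
Next Obligation. exact: eq_exist. Qed.
Next Obligation. exact: eq_exist. Qed.

Definition OHa (d : Order.disp_t) : category :=
  @full_subcategory (OOLat d) (fun P : ooLattice d => is_heyting P).

Definition OBa (d : Order.disp_t) : category :=
  @full_subcategory (OHa d)
    (fun P : {P : ooLattice d | is_heyting P} => is_boolean (sval P)).

Definition preserves_joins (d : Order.disp_t) (A B : porderType d)
    (f : A -> B) : Prop :=
  forall (I : Type) (p : I -> A) (s : A),
    is_join p s -> is_join (fun i => f (p i)) (f s).

Lemma preserves_joins_id (d : Order.disp_t) (A : porderType d) :
  preserves_joins (fun p : A => p).
Proof. by []. Qed.

Lemma preserves_joins_comp (d : Order.disp_t) (A B C : porderType d)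
    (g : B -> C) (f : A -> B) :
  preserves_joins g -> preserves_joins f -> preserves_joins (fun p => g (f p)).
Proof. by move=> mg mf I p s /mf/mg. Qed.

(* MathComp's complemented bounded distributive lattices are the Boolean
   algebras. *)
Program Definition BaJoin (d : Order.disp_t) : category :=
  @Category (ctbDistrLatticeType d)
    (fun A B => {f : A -> B | preserves_joins f})
    (fun A => exist _ (fun p => p) (@preserves_joins_id d A))
    (fun A B C g f => exist _ (fun p => sval g (sval f p))
                        (preserves_joins_comp (svalP g) (svalP f))) _ _ _.
Next Obligation. exact: eq_exist. Qed.
Next Obligation. exact: eq_exist. Qed.
Next Obligation. exact: eq_exist. Qed.

(* Main.v *)
(* Excluded middle turns the overlap relation of an oo-lattice into
   [p `&` q <> \bot]; density applied to this relation yields double negation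
   elimination for the opposite, so the lattice is a Boolean algebra. A map that
   preserves existing joins is then an oo-morphism: if no witness [a] existed for
   [f p] and [q], the elements [y] with [f y `&` q = \bot] would be dense below
   [p], so [p] would be their join and [f p] would be disjoint from [q]. *)
From Pilot Require Import Defs.
From HB Require Import structures.
From mathcomp Require Import all_boot all_order.
From mathcomp Require Import boolp classical_sets.
(* [Defs.comp] must take precedence over [ssrfun.comp]. *)
Import Pilot.Defs.

Set Implicit Arguments.
Unset Strict Implicit.
Unset Printing Implicit Defensive.

Import Order.Theory.

(** * Composition of equivalences and full subcategories *)

Section Categories.
Implicit Types C D E : category.

Lemma is_iso_id C (A : C) : is_iso (idm A).
Proof. by exists (idm A); rewrite comp_idl. Qed.

Lemma is_iso_comp C (X Y Z : C) (g : hom Y Z) (f : hom X Y) :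
  is_iso g -> is_iso f -> is_iso (comp g f).
Proof.
move=> [g' [g'g gg']] [f' [f'f ff']]; exists (comp f' g'); split.
  by rewrite -comp_assoc (comp_assoc g') g'g comp_idl.
by rewrite -comp_assoc (comp_assoc f) ff' comp_idl.
Qed.

Lemma is_iso_fmap C D (F : functor C D) (X Y : C) (f : hom X Y) :
  is_iso f -> is_iso (fmap F f).
Proof.
by move=> [g [gf fg]]; exists (fmap F g); rewrite -!fmap_comp gf fg !fmap_id.
Qed.

(** The inner round trip is contracted first, under [G], then the outer one. Exchanging the roles of
    the functors yields the other half of an equivalence. *)
Lemma naturally_isomorphic_conj C D E (F : functor C D) (G : functor D C)
    (F' : functor D E) (G' : functor E D) :
  naturally_isomorphic (functor_comp G F) (functor_id C) ->
  naturally_isomorphic (functor_comp G' F') (functor_id D) ->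
  naturally_isomorphic (functor_comp (functor_comp G G') (functor_comp F' F))
    (functor_id C).
Proof.
move=> [t [tN tI]] [s [sN sI]].
exists (fun X : C => comp (t X) (fmap G (s (F X)))); split=> [X Y f|X].
  rewrite comp_assoc (tN _ _ f) -!comp_assoc; congr (comp _ _).
  rewrite /= -!fmap_comp; congr (fmap G _).
  exact: (sN _ _ (fmap F f)).
exact: is_iso_comp (tI X) (is_iso_fmap G (sI (F X))).
Qed.

Lemma equivalent_categories_trans C D E :
  equivalent_categories C D -> equivalent_categories D E ->
  equivalent_categories C E.
Proof.
move=> [F [G [GF FG]]] [F' [G' [GF' FG']]].
exists (functor_comp F' F), (functor_comp G G').
by split; exact: naturally_isomorphic_conj.
Qed.

Lemma full_subcategory_all C (P : C -> Prop) : (forall X : C, P X) ->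
  equivalent_categories C (full_subcategory P).
Proof.
move=> PC.
pose F : functor C (full_subcategory P) := @Functor C (full_subcategory P)
  (fun X => exist _ X (PC X)) (fun X Y f => f)
  (fun X => erefl) (fun X Y Z g f => erefl).
pose G : functor (full_subcategory P) C := @Functor (full_subcategory P) C
  (fun X => sval X) (fun X Y f => f)
  (fun X => erefl) (fun X Y Z g f => erefl).
exists F, G; split.
  exists (fun X : C => idm X); split=> [X Y f|X]; last exact: is_iso_id.
  by rewrite /= comp_idl comp_idr.
(* The round trip alters at most the proof of [P], which arrows do not see. *)
exists (fun X : full_subcategory P => idm (sval X)); split=> [X Y f|X].
  by rewrite /= comp_idl comp_idr.
exact: (is_iso_id (sval X)).
Qed.

End Categories.

Local Open Scope order_scope.

Lemma is_base_setT (d : Order.disp_t) (L : porderType d) :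
  is_base [set: L]%classic.
Proof. by move=> p; split=> [a []//|u]; apply; split. Qed.

Lemma preserves_joins_le (d : Order.disp_t) (A B : porderType d) (f : A -> B) :
  preserves_joins f -> forall p q : A, p <= q -> f p <= f q.
Proof.
move=> mf p q pq.
(* Comparability as a join: [q] is the join of the pair [p], [q]. *)
have qJ : is_join (fun b : bool => if b then p else q) q.
  by split=> [_ [[] _ <-]//|x]; apply; exists false.
by apply: (mf _ _ _ qJ).1; exists true.
Qed.

(** * Boolean structure of an oo-lattice *)

Section OverlapClassical.
Variables (d : Order.disp_t) (P : ooLattice d).
Implicit Types p q r : P.

(** Nothing overlaps [\bot], the empty join, so meet closure gives one direction. Conversely, by
    density a nonzero meet overlaps some [r]; meet closure moves this overlap below [q]. *)
Lemma overlapP p q : overlap p q <-> p `&` q <> \bot.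
Proof.
have overlap0 r : ~ overlap r \bot.
  have bot_join : is_join (fun v : void => match v return P with end) \bot.
    by split=> [_ [[]]|x _]; exact: le0x.
  by move/(overlap_join bot_join) => [[]].
split=> [/overlap_meet + pq0|pq0]; first by rewrite pq0; exact: overlap0.
have [r /overlap_sym/overlap_meet rpq] : exists r, overlap r (p `&` q).
  apply: contrapT => npq; apply: pq0; apply/eqP; rewrite -lex0.
  by apply: overlap_density => r rpq; case: npq; exists r.
have pq_q : p `&` q `&` r <= q by rewrite meetAC leIr.
apply/overlap_sym/(overlap_le (leIl p q))/overlap_sym.
exact: overlap_le pq_q rpq.
Qed.

Lemma meet_opposite p : p `&` opposite p = \bot.
Proof. by rewrite meetC; apply/opposite_pseudo. Qed.

(** Whatever is disjoint from [p] lies below [opposite p], so it is disjoint from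
    [opposite (opposite p)]; density concludes. *)
Lemma oppositeK p : opposite (opposite p) = p.
Proof.
apply/le_anti/andP; split; last exact/opposite_pseudo/meet_opposite.
apply: overlap_density => r /overlapP rpp; apply/overlapP => /opposite_pseudo rp.
apply/rpp/eqP; rewrite -lex0 -(meet_opposite (opposite p)).
by apply: leI2.
Qed.

Lemma le_meet_opposite p q : p `&` opposite q = \bot <-> p <= q.
Proof. by rewrite opposite_pseudo oppositeK. Qed.

Lemma meet_join_bot p q r :
  p `&` q = \bot -> p `&` r = \bot -> p `&` (q `|` r) = \bot.
Proof.
rewrite ![p `&` _]meetC => /opposite_pseudo qp /opposite_pseudo rp.
by apply/opposite_pseudo; rewrite leUx qp.
Qed.

(** The opposite of the join lies below both [opposite p] and [opposite (opposite p)], whose meet is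
    [\bot]. *)
Lemma join_opposite p : p `|` opposite p = \top.
Proof.
apply/eqP; rewrite -le1x; apply/le_meet_opposite/eqP.
set u := p `|` _; rewrite -lex0 -(meet_opposite (opposite p)) meet1x.
have below_u q : q <= u -> opposite u <= opposite q.
  move=> qu; apply/opposite_pseudo/eqP; rewrite -lex0 -(meet_opposite u) meetC.
  by apply: leI2.
by rewrite lexI !below_u ?leUl ?leUr.
Qed.

(** With [s] the right-hand side, the meet of [p] and [opposite s] is disjoint from [q] and from
    [r], hence from their join. *)
Lemma oo_meetUr p q r : p `&` (q `|` r) = (p `&` q) `|` (p `&` r).
Proof.
apply/le_anti/andP; split; last first.
  by rewrite leUx !leI2 ?leUl ?leUr.
set s := (X in _ <= X); apply/le_meet_opposite.
have meet_s t : p `&` t <= s -> p `&` opposite s `&` t = \bot.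
  by move=> pts; rewrite meetAC; apply/le_meet_opposite.
rewrite meetAC; apply: meet_join_bot; apply: meet_s.
  exact: leUl.
exact: leUr.
Qed.

Lemma oo_meetUl : @left_distributive P P Order.meet Order.join.
Proof. by move=> p q r; rewrite meetC oo_meetUr !(meetC r). Qed.

Lemma oo_boolean : is_boolean P.
Proof.
split=> [|p]; first exact: oo_meetUr.
by exists (opposite p); rewrite meet_opposite join_opposite.
Qed.

Lemma oo_heyting : is_heyting P.
Proof.
(* Classical implication: not both [p] and not [q]. *)
move=> p q; exists (opposite (p `&` opposite q)) => x.
by rewrite -opposite_pseudo meetA le_meet_opposite.
Qed.

End OverlapClassical.

(** * Oo-morphisms as join-preserving maps *)

Section Morphisms.
Variables (d : Order.disp_t) (P Q : ooLattice d).

(** If [f s] were not below an upper bound [u], it would overlap [opposite u]. The witness [a]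
    overlaps [s], hence some [p i], and then [f (p i)] overlaps [opposite u] as well. *)
Lemma oo_morphism_preserves_joins (f : P -> Q) :
  oo_morphism f -> preserves_joins f.
Proof.
move=> mf; have fT := mf _ (@is_base_setT _ P); have f_le := oo_morphism_le fT.
move=> J p s ps; split=> [_ [i _ <-]|u u_ub].
  by apply: f_le; apply: ps.1; exists i.
apply/le_meet_opposite; apply: contrapT => /overlapP fsu.
have [a [_ /overlap_sym sa aP]] := (fT _ _).1 fsu.
have [i /overlap_sym pia] := (overlap_join ps a).1 sa.
have /overlapP := aP (p i) Logic.I pia; apply; apply/le_meet_opposite.
by apply: u_ub; exists i.
Qed.

Lemma preserves_joins_oo_morphism (f : P -> Q) :
  preserves_joins f -> oo_morphism f.
Proof.
move=> mf S bS p q; split=> [/overlapP fpq|[a [Sa pa aP]]]; last first.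
  have [x [Sx xp /overlap_sym xa]] := overlap_base bS (overlap_sym pa).
  apply/overlap_sym/(overlap_le (preserves_joins_le mf xp))/overlap_sym.
  exact: aP.
(* A witness outside the base can be shrunk to a base element. *)
suff [a pa aP] : exists2 a, overlap p a &
    forall x, overlap x a -> overlap (f x) q.
  have [b [Sb ba pb]] := overlap_base bS pa.
  by exists b; split=> // x _ xb; apply: aP; exact: overlap_le ba xb.
apply: contrapT => noa; apply: fpq; apply/opposite_pseudo.
pose Y := {y : P | y <= p /\ f y `&` q = \bot}.
have pY : is_join (fun y : Y => sval y) p.
  split=> [_ [[y [yp fy]] _ <-]//|u u_ub].
  apply/le_meet_opposite; apply: contrapT => pu0; apply: noa.
  (* The part of [p] outside [u] is a witness: a nonzero piece of it whose image misses [q] would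
     belong to [Y], hence lie below both [u] and [opposite u]. *)
  exists (p `&` opposite u).
    by apply/overlapP; rewrite meetA meetxx.
  move=> x /overlapP xpu; apply/overlapP => fxq; apply: xpu.
  set y := x `&` _.
  have yp : y <= p by rewrite /y meetCA leIl.
  have yu : y <= opposite u by rewrite /y meetA leIr.
  have fy : f y `&` q = \bot.
    apply/eqP; rewrite -lex0 -fxq leI2 //.
    by apply: preserves_joins_le => //; exact: leIl.
  have {}u_ub : y <= u by apply: u_ub; exists (exist _ y (conj yp fy)).
  apply/eqP; rewrite -lex0 -(meet_opposite u).
  by rewrite lexI u_ub.
apply: (mf _ _ _ pY).2 => _ [[y [yp fy]] _ <-].
exact/opposite_pseudo.
Qed.

End Morphisms.

(** * Passage between Boolean algebras and oo-lattices *)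

Section BooleanOverlap.
Variables (d : Order.disp_t) (B : ctbDistrLatticeType d).
Implicit Types p q r : B.

(** The only possible choice, by [overlapP]. *)
Let ov p q := p `&` q <> \bot.

Fact ba_opposite_pseudo p q : p `&` q = \bot <-> p <= ~` q.
Proof. by rewrite -disj_leC; split=> /eqP. Qed.

Fact ba_overlap_sym p q : ov p q -> ov q p.
Proof. by rewrite /ov meetC. Qed.

Fact ba_overlap_meet p q : ov p q -> ov p (p `&` q).
Proof. by rewrite /ov meetA meetxx. Qed.

Fact ba_overlap_join (I : Type) (q : I -> B) (s : B) : is_join q s ->
  forall p, ov p s <-> exists i, ov p (q i).
Proof.
move=> [s_ub s_lub] p; split=> [ps|[i piq] ps].
  apply: contrapT => npq; apply: ps; rewrite meetC; apply/ba_opposite_pseudo.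
  (* If [p] is disjoint from every [q i], its complement bounds the family. *)
  apply: s_lub => _ [i _ <-]; apply/ba_opposite_pseudo; rewrite meetC.
  by apply: contrapT => piq; apply: npq; exists i.
apply: piq; apply/eqP; rewrite -lex0 -ps leI2 //.
by apply: s_ub; exists i.
Qed.

Fact ba_overlap_density p q : (forall r, ov r p -> ov r q) -> p <= q.
Proof.
move=> pq; rewrite -[q]complK; apply/ba_opposite_pseudo; apply: contrapT => pq0.
apply: (pq (p `&` ~` q)); first by rewrite /ov meetAC meetxx.
by rewrite -meetA meetCx meetx0.
Qed.

Fact ba_set_based : exists S : set B, is_base S.
Proof. by exists [set: B]%classic; exact: is_base_setT. Qed.

Definition ooLattice_of_ba : ooLattice d :=
  @OOLattice d B ov Order.compl ba_opposite_pseudo ba_overlap_sym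
    ba_overlap_meet ba_overlap_join ba_overlap_density ba_set_based.

End BooleanOverlap.

Section BooleanOfOverlap.
Variables (d : Order.disp_t) (P : ooLattice d).

Definition tbDistrLattice_of_ooLattice : tbDistrLatticeType d :=
  HB.pack_for (tbDistrLatticeType d) (Order.TBLattice.sort P)
    (Order.Lattice_Meet_isDistrLattice.Build d P (@oo_meetUl d P)).

Let D := tbDistrLattice_of_ooLattice.

Definition ba_of_ooLattice : ctbDistrLatticeType d :=
  HB.pack_for (ctbDistrLatticeType d) (Order.TBDistrLattice.sort D)
    (Order.TBDistrLattice_hasComplement.Build d D
       (@join_opposite d P) (@meet_opposite d P)).

End BooleanOfOverlap.

Section Functors.
Variable d : Order.disp_t.

(** Transparent, so that the round trips can be computed on objects. *)
Definition BaJoin_to_OOLat : functor (BaJoin d) (OOLat d).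
Proof.
exists (fun B : BaJoin d => ooLattice_of_ba B : OOLat d)
  (fun A B f => exist _ (sval f)
     (@preserves_joins_oo_morphism d (ooLattice_of_ba A) (ooLattice_of_ba B)
        (sval f) (svalP f))).
  by move=> A; exact: eq_exist.
by move=> A B C g f; exact: eq_exist.
Defined.

Definition OOLat_to_BaJoin : functor (OOLat d) (BaJoin d).
Proof.
exists (fun P : OOLat d => ba_of_ooLattice P : BaJoin d)
  (fun P Q f => exist _ (sval f)
     (@oo_morphism_preserves_joins d P Q (sval f) (svalP f))).
  by move=> A; exact: eq_exist.
by move=> A B C g f; exact: eq_exist.
Defined.

(* Both round trips preserve the underlying bounded lattice up to conversion, so
   the identity map is a natural isomorphism. *)
Lemma equivalent_BaJoin_OOLat : equivalent_categories (BaJoin d) (OOLat d).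
Proof.
exists BaJoin_to_OOLat, OOLat_to_BaJoin; split.
  exists (fun B : BaJoin d => exist _ (fun b : B => b)
    (@preserves_joins_id d (B : ctbDistrLatticeType d))).
  split=> [A B f|B]; first exact: eq_exist.
  exists (exist _ (fun b : B => b)
    (@preserves_joins_id d (B : ctbDistrLatticeType d))).
  by split; exact: eq_exist.
pose to P := @preserves_joins_oo_morphism d
  (ooLattice_of_ba (ba_of_ooLattice P)) P id (@preserves_joins_id d P).
pose from P := @preserves_joins_oo_morphism d
  P (ooLattice_of_ba (ba_of_ooLattice P)) id (@preserves_joins_id d P).
exists (fun P : OOLat d => exist _ _ (to P)).
split=> [P Q f|P]; first exact: eq_exist.
by exists (exist _ _ (from P)); split; exact: eq_exist.
Qed.

End Functors.

Theorem proposition4p16 (d : Order.disp_t) :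
  equivalent_categories (BaJoin d) (OOLat d) /\
  equivalent_categories (BaJoin d) (OHa d) /\
  equivalent_categories (BaJoin d) (OBa d) /\
  equivalent_categories (OOLat d) (OHa d) /\
  equivalent_categories (OOLat d) (OBa d) /\
  equivalent_categories (OHa d) (OBa d).
Proof.
have BaOO := equivalent_BaJoin_OOLat d.
(* Both full subcategories are cut out by properties that always hold. *)
have OOH : equivalent_categories (OOLat d) (OHa d).
  exact/full_subcategory_all/oo_heyting.
have HOB : equivalent_categories (OHa d) (OBa d).
  by apply: full_subcategory_all => P; exact: oo_boolean.
have OOB := equivalent_categories_trans OOH HOB.
have BaH := equivalent_categories_trans BaOO OOH.
by have BaB := equivalent_categories_trans BaOO OOB.
Qed.
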